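(* Let $k$ be an algebraically closed field of characteristic $2$, let $V_4$ be the Klein four group, let $\alpha\in k$ with $\alpha\neq 0,1$, and let $V_1(\alpha)$ be the corresponding two dimensional indecomposable $kV_4$-module. Then the canonical trace on $V_1(\alpha)$ is ambidextrous and, hence, $V_1(\alpha)$ is ambidextrous. Furthermore, $V_2(\alpha)\in\mathcal{I}_{V_1(\alpha)}$ and $\mathsf{d}_{V_1(\alpha)}(V_2(\alpha))=0$.
   Context: $\mathcal{C}$ is the category of finite dimensional $kV_4$-modules with usual tensor product, dual, evaluation $d_V:V^*\otimes V\to k$, coevaluation $b_V:k\to V\otimes V^*$, flip braiding $c$ and trivial twist. Put $b'_V=c_{V,V^*}\circ b_V$, $d'_V=d_V\circ c_{V,V^*}$. For $f\in\operatorname{End}_{\mathcal{C}}(V\otimes W)$ set $\operatorname{tr}_L(f)=(d_V\otimes\operatorname{Id}_W)(\operatorname{Id}_{V^*}\otimes f)(b'_V\otimes\operatorname{Id}_W)\in\operatorname{End}_{\mathcal{C}}(W)$ and $\operatorname{tr}_R(f)=(\operatorname{Id}_V\otimes d'_W)(f\otimes\operatorname{Id}_{W^*})(\operatorname{Id}_V\otimes b_W)\in\operatorname{End}_{\mathcal{C}}(V)$. For an indecomposable module $J$, $\operatorname{End}_{\mathcal{C}}(J)/\operatorname{Rad}(\operatorname{End}_{\mathcal{C}}(J))\cong k$; the canonical projection $\langle\ \rangle:\operatorname{End}_{\mathcal{C}}(J)\to k$ is the canonical trace. It is ambidextrous if $\langle\operatorname{tr}_L(f)\rangle=\langle\operatorname{tr}_R(f)\rangle$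 for all $f\in\operatorname{End}_{\mathcal{C}}(J\otimes J)$, and then $J$ is called ambidextrous. $\mathcal{I}_J$ is the full subcategory of direct summands of modules $J\otimes W$, $W\in\mathcal{C}$. For $J$ ambidextrous and $V\in\mathcal{I}_J$, $\mathsf{d}_J(V)=\langle\operatorname{tr}_R(\alpha'\circ\beta')\rangle$ for any $\alpha':V\to J\otimes W$, $\beta':J\otimes W\to V$ with $\beta'\circ\alpha'=\operatorname{Id}_V$ (independent of choices). Let $g,h$ generate $V_4$, $x=1+g$, $y=1+h$, so $kV_4=k[x,y]/(x^2,y^2)$. For $n\ge 1$, $V_n(\alpha)$ is the $2n$-dimensional module on $k^n\oplus k^n$ on which $x$ acts by $\begin{pmatrix}0&I_n\\0&0\end{pmatrix}$ and $y$ by $\begin{pmatrix}0&J_n(\alpha)\\0&0\end{pmatrix}$, with $J_n(\alpha)$ the $n\times n$ Jordan block with eigenvalue $\alpha$ (so $J_1(\alpha)=(\alpha)$). *)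

(* Defs.v *)
From HB Require Import structures.
From mathcomp Require Import all_boot all_order all_algebra all_fingroup.
From mathcomp Require Import all_solvable all_field all_character.
From mathcomp Require boolp classical_sets.

Set Implicit Arguments.
Unset Strict Implicit.
Unset Printing Implicit Defensive.

Import GroupScope GRing.Theory.
Local Open Scope ring_scope.

(* A finite dimensional kG-module is a [representation F G], with the matrix  *)
(* [V g] acting on the left on column vectors.  A linear map V -> W is thus a *)
(* matrix in 'M_(rdegree W, rdegree V), composition is [*m], and the tensor   *)
(* product of linear maps is the Kronecker product [tprod].  The basis vector *)
(* e_i (x) e_j of V (x) W has index [mxvec_index i j] (see [tprod_index]).    *)

Lemma index_allpairs_pair (T1 T2 : eqType) (s : seq T1) (t : seq T2) x y :
  x \in s -> y \in t ->
  index (x, y) [seq (a, b) | a <- s, b <- t] = (index x s * size t + index y t)%N.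
Proof.
move=> + t_y; elim: s => //= a s IH; rewrite inE index_cat size_map.
have [-> _|neq_ax /= s_x] := eqVneq a x.
  rewrite map_f // index_map // => b c []; exact.
case: ifP => [/mapP[b _ [e _]]|_]; first by rewrite e eqxx in neq_ax.
by rewrite IH ?mulSn ?addnA // (negPf neq_ax); case/orP: s_x => // /eqP e; rewrite e eqxx in neq_ax.
Qed.

Lemma val_mxvec_index m n (i : 'I_m) (j : 'I_n) :
  mxvec_index i j = (i * n + j)%N :> nat.
Proof.
rewrite /mxvec_index /= /enum_rank [enum_rank_in]unlock insubdK.
  rewrite enumT unlock /= /prod_enum index_allpairs_pair ?mem_enum //.
  by rewrite !index_enum_ord size_enum_ord.
by rewrite unfold_in /= cardE index_mem mem_enum.
Qed.

Lemma tprod_index (F : fieldType) m1 n1 (A : 'M[F]_(m1, n1)) m2 n2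
    (B : 'M[F]_(m2, n2)) i1 i2 j1 j2 :
  tprod A B (mxvec_index i1 i2) (mxvec_index j1 j2) = A i1 j1 * B i2 j2.
Proof.
have trowE n (a : 'rV[F]_n) (j : 'I_n) :
    trow a B i2 (mxvec_index j j2) = a 0 j * B i2 j2.
  elim: n a j => [|n IH] a j; first by case: j.
  rewrite /= mxE; case: splitP => l /(etrans (esym (val_mxvec_index j j2))).
    case: (unliftP 0 j) => [j' ->|->] /=.
      by move=> e; have := ltn_ord l; rewrite -e /= /bump /= mulnDl mul1n -addnA ltnNge leq_addr.
    rewrite mul0n add0n => /val_inj <-; rewrite !mxE; congr (a _ _ * _).
    by apply: val_inj.
  case: (unliftP 0 j) => [j' ->|->] /=; last first.
    by move=> e; have := ltn_ord j2; rewrite [X in (X < _)%N -> _]e ltnNge leq_addr.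
  rewrite /= /bump /= mulnDl mul1n -addnA => /addnI e.
  have -> : l = mxvec_index j' j2 by apply: val_inj; apply: etrans (esym e) (esym (val_mxvec_index _ _)).
  rewrite IH mxE; congr (a _ _ * _); first exact: val_inj.
elim: m1 A i1 => [|m1 IH] A i1; first by case: i1.
rewrite /= mxE; case: splitP => l /(etrans (esym (val_mxvec_index i1 i2))).
  case: (unliftP 0 i1) => [i' ->|->] /=.
    by move=> e; have := ltn_ord l; rewrite -e /= /bump /= mulnDl mul1n -addnA ltnNge leq_addr.
  rewrite mul0n add0n => /val_inj <-; rewrite trowE mxE; congr (A _ _ * _).
  exact: val_inj.
case: (unliftP 0 i1) => [i' ->|->] /=; last first.
  by move=> e; have := ltn_ord i2; rewrite [X in (X < _)%N -> _]e ltnNge leq_addr.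
rewrite /= /bump /= mulnDl mul1n -addnA => /addnI e.
have -> : l = mxvec_index i' i2 by apply: val_inj; apply: etrans (esym e) (esym (val_mxvec_index _ _)).
rewrite IH mxE; congr (A _ _ * _); exact: val_inj.
Qed.

Lemma sum_mxvec (A : nmodType) m n (E : 'I_(m * n) -> A) :
  \sum_s E s = \sum_i \sum_j E (mxvec_index i j).
Proof.
rewrite (reindex _ (curry_mxvec_bij m n)) pair_bigA /=.
by apply: eq_bigr => -[].
Qed.

Lemma mxvec_index_eq m n (i i' : 'I_m) (j j' : 'I_n) :
  (mxvec_index i j == mxvec_index i' j') = (i == i') && (j == j').
Proof.
apply/eqP/andP => [/cast_ord_inj/enum_rank_inj[-> ->] | [/eqP-> /eqP->] //].
by rewrite !eqxx.
Qed.

Section Category.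

Variables (F : fieldType) (gT : finGroupType) (G : {group gT}).
Local Notation rep := (representation F G).
Implicit Types V W U J : rep.

Definition is_hom V W (f : 'M[F]_(rdegree W, rdegree V)) : Prop :=
  forall g, g \in G -> W g *m f = f *m V g.
Arguments is_hom : clear implicits.

Lemma unit_mx_repr : mx_repr G (fun _ : gT => 1%:M : 'M[F]_1).
Proof. by split=> // g h _ _; rewrite mul1mx. Qed.
Definition unit_obj : rep := Representation (MxRepresentation unit_mx_repr).

Lemma dual_mx_repr V : mx_repr G (fun g : gT => (V g^-1%g)^T).
Proof.
split=> [|g h Gg Gh]; first by rewrite invg1 repr_mx1 trmx1.
by rewrite invMg repr_mxM ?groupV // trmx_mul.
Qed.
Definition dual V : rep := Representation (MxRepresentation (dual_mx_repr V)).

Definition tens V W : rep := Representation (prod_repr V W).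

Definition assoc V W U :
    'M[F]_(rdegree (tens (tens V W) U), rdegree (tens V (tens W U))) :=
  \sum_i \sum_j \sum_l
    delta_mx (mxvec_index (mxvec_index i j) l)
             (mxvec_index i (mxvec_index j l)).

Definition unitl W : 'M[F]_(rdegree W, rdegree (tens unit_obj W)) :=
  \sum_i delta_mx i (mxvec_index ord0 i).

Definition unitr V : 'M[F]_(rdegree V, rdegree (tens V unit_obj)) :=
  \sum_i delta_mx i (mxvec_index i ord0).

Definition ev V : 'M[F]_(rdegree unit_obj, rdegree (tens (dual V) V)) :=
  \sum_i delta_mx ord0 (mxvec_index i i).

Definition coev V : 'M[F]_(rdegree (tens V (dual V)), rdegree unit_obj) :=
  \sum_i delta_mx (mxvec_index i i) ord0.

Definition braid V W : 'M[F]_(rdegree (tens W V), rdegree (tens V W)) :=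
  \sum_i \sum_j delta_mx (mxvec_index j i) (mxvec_index i j).

Definition coev' V : 'M[F]_(rdegree (tens (dual V) V), rdegree unit_obj) :=
  braid V (dual V) *m coev V.

Definition ev' V : 'M[F]_(rdegree unit_obj, rdegree (tens V (dual V))) :=
  ev V *m braid V (dual V).

(* The matrices [assoc], [unitl] and [unitr] are permutation matrices, whose  *)
(* inverses are their transposes.                                             *)
Definition tr_L V W (f : 'M[F]_(rdegree (tens V W))) : 'M[F]_(rdegree W) :=
  unitl W *m tprod (ev V) (1%:M : 'M_(rdegree W)) *m assoc (dual V) V W
  *m tprod (1%:M : 'M_(rdegree (dual V))) f
  *m (assoc (dual V) V W)^T *m tprod (coev' V) (1%:M : 'M_(rdegree W))
  *m (unitl W)^T.
Arguments tr_L : clear implicits.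

Definition tr_R V W (f : 'M[F]_(rdegree (tens V W))) : 'M[F]_(rdegree V) :=
  unitr V *m tprod (1%:M : 'M_(rdegree V)) (ev' W)
  *m (assoc V W (dual W))^T
  *m tprod f (1%:M : 'M_(rdegree (dual W)))
  *m assoc V W (dual W) *m tprod (1%:M : 'M_(rdegree V)) (coev W)
  *m (unitr V)^T.
Arguments tr_R : clear implicits.

Definition indecomposable J : Prop :=
  (0 < rdegree J)%N /\
  forall U W, mx_rsim J (dadd_grepr U W) -> rdegree U = 0%N \/ rdegree W = 0%N.

(* Endomorphism algebras and their left ideals are spaces of matrices, encoded *)
(* by row spaces as usual in mxalgebra; see [End_mxP].  No left ideal is lost, *)
(* as left ideals are stable under scaling.  The Jacobson radical is the       *)
(* intersection of the maximal left ideals.                                    *)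
Definition End_mx V : 'A[F]_(rdegree V) := 'C(enveloping_algebra_mx V)%MS.

Definition max_left_ideal V (S : 'A[F]_(rdegree V)) : Prop :=
  [/\ (S < End_mx V)%MS, left_mx_ideal (End_mx V) S
    & forall T : 'A[F]_(rdegree V), (T < End_mx V)%MS ->
        left_mx_ideal (End_mx V) T -> (S <= T)%MS -> (T <= S)%MS].
Arguments max_left_ideal : clear implicits.

Definition in_radical V (f : 'M[F]_(rdegree V)) : Prop :=
  (f \in End_mx V)%MS /\ forall S, max_left_ideal V S -> (f \in S)%MS.
Arguments in_radical : clear implicits.

(* The scalar c such that f is c Id modulo the radical (see [ctraceP]).       *)
Definition ctrace J (f : 'M[F]_(rdegree J)) : F :=
  classical_sets.xget 0 (fun c => in_radical J (f - c%:M)).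
Arguments ctrace : clear implicits.

Definition ctrace_ambidextrous J : Prop :=
  forall f : 'M[F]_(rdegree (tens J J)),
    is_hom (tens J J) (tens J J) f -> ctrace J (tr_L J J f) = ctrace J (tr_R J J f).

Definition ambidextrous J : Prop :=
  indecomposable J /\ ctrace_ambidextrous J.

Definition in_ideal J V : Prop :=
  exists W U, mx_rsim (tens J W) (dadd_grepr V U).

(* Stated as a relation with d, so that independence of the choice of W, a and *)
(* b is part of it; d is unique because some retraction b exists.              *)
Definition is_mod_dim J V (d : F) : Prop :=
  in_ideal J V /\
  forall W (a : 'M[F]_(rdegree (tens J W), rdegree V))
           (b : 'M[F]_(rdegree V, rdegree (tens J W))),
    is_hom V (tens J W) a -> is_hom (tens J W) V b -> b *m a = 1%:M ->
    ctrace J (tr_R J W (a *m b)) = d.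

End Category.

Arguments is_hom {F gT G} V W f.
Arguments tr_L {F gT G} V W f.
Arguments tr_R {F gT G} V W f.
Arguments max_left_ideal {F gT G} V S.
Arguments in_radical {F gT G} V f.
Arguments ctrace {F gT G} J f.

Section CategoryTheory.

Variables (F : fieldType) (gT : finGroupType) (G : {group gT}).
Local Notation rep := (representation F G).
Implicit Types V W U J : rep.

Lemma sum_pick (I : finType) (i0 : I) (E : I -> F) :
  \sum_i (i == i0)%:R * E i = E i0.
Proof.
rewrite (bigD1 i0) //= eqxx mul1r big1 ?addr0 // => i /negPf->.
by rewrite mul0r.
Qed.

Lemma evE V i j : ev V 0 (mxvec_index i j) = (i == j)%:R.
Proof.
rewrite summxE; under eq_bigr => l _ do
  rewrite mxE eqxx mxvec_index_eq /= !(eq_sym _ l) -mulnb natrM.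
by rewrite sum_pick.
Qed.

Lemma coevE V i j : coev V (mxvec_index i j) 0 = (i == j)%:R.
Proof.
rewrite summxE; under eq_bigr => l _ do
  rewrite mxE andbT mxvec_index_eq /= !(eq_sym _ l) -mulnb natrM.
by rewrite sum_pick.
Qed.

Lemma unitlE W i j l : unitl W i (mxvec_index j l) = (i == l)%:R.
Proof.
rewrite (ord1 j) summxE; under eq_bigr => r _.
  rewrite mxE mxvec_index_eq.
  rewrite eqxx !(eq_sym _ r) -mulnb natrM; over.
by rewrite sum_pick.
Qed.

Lemma unitrE V i j l : unitr V i (mxvec_index j l) = (i == j)%:R.
Proof.
rewrite (ord1 l) summxE; under eq_bigr => r _.
  rewrite mxE mxvec_index_eq.
  rewrite eqxx andbT !(eq_sym _ r) -mulnb natrM; over.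
by rewrite sum_pick.
Qed.

Lemma braidE V W i j i' j' :
  braid V W (mxvec_index j i) (mxvec_index i' j') =
    (i == i')%:R * (j == j')%:R.
Proof.
rewrite summxE; under eq_bigr => r _.
  rewrite summxE; under eq_bigr => s _.
    rewrite mxE !mxvec_index_eq (_ : _ && _ = (s == j) && ((r == i) &&
         ((i' == r) && (j' == s)))); last first.
      by rewrite (eq_sym s) (eq_sym r) !andbA.
    rewrite -[X in X%:R]mulnb natrM; over.
  rewrite sum_pick -mulnb natrM; over.
by rewrite sum_pick -mulnb natrM eq_sym (eq_sym j').
Qed.

Lemma assocE V W U i j l i' j' l' :
  assoc V W U (mxvec_index (mxvec_index i j) l)
              (mxvec_index i' (mxvec_index j' l')) =
    (i == i')%:R * ((j == j')%:R * (l == l')%:R).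
Proof.
rewrite summxE; under eq_bigr => r _.
  rewrite summxE; under eq_bigr => s _.
    rewrite summxE; under eq_bigr => t _.
      rewrite mxE !mxvec_index_eq.
      rewrite (_ : _ && _ = (t == l) && ((s == j) && ((r == i) &&
         ((i' == r) && ((j' == s) && (l' == t)))))); last first.
        rewrite (eq_sym s) (eq_sym r) (eq_sym t).
        by do !case: (_ == _).
      rewrite -[X in X%:R]mulnb natrM.
      over.
    rewrite sum_pick -mulnb natrM; over.
  rewrite sum_pick -mulnb natrM; over.
by rewrite sum_pick -!mulnb !natrM (eq_sym i') (eq_sym j') (eq_sym l').
Qed.

Lemma coev'E V i j : coev' V (mxvec_index i j) 0 = (i == j)%:R.
Proof.
rewrite mxE sum_mxvec; under eq_bigr => r _.
  under eq_bigr => s _ do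
    rewrite braidE coevE -mulrA (eq_sym j) (eq_sym i) mulrCA.
  rewrite sum_pick; over.
by rewrite sum_pick eq_sym.
Qed.

Lemma ev'E V i j : ev' V 0 (mxvec_index i j) = (i == j)%:R.
Proof.
rewrite mxE sum_mxvec; under eq_bigr => r _.
  under eq_bigr => s _ do rewrite mulrC braidE evE -mulrA.
  rewrite sum_pick; over.
by rewrite sum_pick eq_sym.
Qed.


Lemma sum_pickr (I : finType) (i0 : I) (E : I -> F) :
  \sum_i E i * (i == i0)%:R = E i0.
Proof. by under eq_bigr => i _ do rewrite mulrC; rewrite sum_pick. Qed.

Lemma mul_assoc V W U m (M : 'M[F]_(m, rdegree (tens (tens V W) U))) i s t u :
  (M *m assoc V W U) i (mxvec_index s (mxvec_index t u)) =
    M i (mxvec_index (mxvec_index s t) u).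
Proof.
rewrite mxE sum_mxvec; under eq_bigr => st _.
  over.
rewrite sum_mxvec; under eq_bigr => a _.
  under eq_bigr => b _.
    under eq_bigr => c _ do rewrite assocE !mulrA.
    rewrite sum_pickr; over.
  rewrite sum_pickr; over.
by rewrite sum_pickr.
Qed.

Lemma mul_assocT V W U m (M : 'M[F]_(m, rdegree (tens V (tens W U)))) i s t u :
  (M *m (assoc V W U)^T) i (mxvec_index (mxvec_index s t) u) =
    M i (mxvec_index s (mxvec_index t u)).
Proof.
rewrite mxE sum_mxvec; under eq_bigr => a _.
  rewrite sum_mxvec; under eq_bigr => b _.
    under eq_bigr => c _.
      rewrite mxE assocE (eq_sym s) (eq_sym t) (eq_sym u) !mulrA.
      over.
    rewrite sum_pickr; over.
  rewrite sum_pickr; over.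
by rewrite sum_pickr.
Qed.

Lemma tr_LE V W f i j :
  tr_L V W f i j = \sum_l f (mxvec_index l i) (mxvec_index l j).
Proof.
rewrite /tr_L -2!mulmxA.
have P1 s t u : (unitl W *m tprod (ev V) (1%:M : 'M_(rdegree W))
      *m assoc (dual V) V W) i (mxvec_index s (mxvec_index t u))
    = (t == s)%:R * (u == i)%:R.
  rewrite mul_assoc mxE sum_mxvec [LHS]big_ord1.
  under eq_bigr => w _ do rewrite unitlE tprod_index evE mxE (eq_sym i).
  by rewrite sum_pick (eq_sym s) (eq_sym i).
rewrite mxE sum_mxvec.
under eq_bigr => s _.
  rewrite sum_mxvec; under eq_bigr => t _.
    under eq_bigr => u _.
      rewrite (_ : (_ *m tprod _ f) i _ =
                  f (mxvec_index s i) (mxvec_index t u)); last first.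
        rewrite mxE sum_mxvec; under eq_bigr => s' _.
          rewrite sum_mxvec; under eq_bigr => t' _.
            under eq_bigr => u' _ do
              rewrite P1 tprod_index mxE mulrAC.
            rewrite sum_pickr; over.
          rewrite sum_pick; over.
        by rewrite sum_pick.
      rewrite (_ : (_ *m _) _ j = (t == s)%:R * (u == j)%:R); last first.
        rewrite -[_ *m _]trmxK mxE trmx_mul trmxK mul_assoc 2!mxE.
        rewrite sum_mxvec [LHS]big_ord1.
        under eq_bigr => w _ do
          rewrite tprod_index coev'E !mxE unitlE (eq_sym j) (eq_sym s).
        by rewrite sum_pickr.
      rewrite mulrA; over.
    rewrite sum_pickr; over.
  rewrite sum_pickr; over.
by [].
Qed.

Lemma tr_RE V W f i j :
  tr_R V W f i j = \sum_l f (mxvec_index i l) (mxvec_index j l).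
Proof.
rewrite /tr_R -2!mulmxA.
have P1 s t u : (unitr V *m tprod (1%:M : 'M_(rdegree V)) (ev' W)
      *m (assoc V W (dual W))^T) i (mxvec_index (mxvec_index s t) u)
    = (s == i)%:R * (t == u)%:R.
  rewrite mul_assocT mxE sum_mxvec.
  under eq_bigr => w _.
    rewrite [\sum_j0 _]big_ord1 unitrE tprod_index ev'E mxE (eq_sym i).
    over.
  by rewrite sum_pick (eq_sym s) (eq_sym i).
rewrite mxE sum_mxvec.
under eq_bigr => s _.
  under eq_bigr => u _.
    rewrite (_ : (_ *m tprod f _) i _ =
                f (mxvec_index i u) s); last first.
      rewrite mxE sum_mxvec; under eq_bigr => s' _.
        under eq_bigr => u' _.
          rewrite tprod_index [1%:M _ _]mxE mulrA.
          over.
        rewrite sum_pickr; over.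
      rewrite sum_mxvec; under eq_bigr => s' _.
        under eq_bigr => t' _ do rewrite P1 mulrAC.
        rewrite sum_pickr; over.
      by rewrite sum_pick.
    over.
  over.
rewrite sum_mxvec /=.
under eq_bigr => s _.
  under eq_bigr => t _.
    under eq_bigr => u _.
      rewrite (_ : (_ *m _) _ j = (s == j)%:R * (u == t)%:R); last first.
        rewrite -[assoc _ _ _]trmxK -[_ *m _]trmxK mxE trmx_mul trmxK.
        rewrite mul_assocT 2!mxE sum_mxvec.
        under eq_bigr => w _.
          rewrite [\sum_j0 _]big_ord1 tprod_index coevE !mxE unitrE.
          rewrite (eq_sym j).
          over.
        by rewrite /= sum_pickr (eq_sym u).
      rewrite mulrA; over.
    rewrite sum_pickr; over.
  rewrite /=; under eq_bigr => t _ do rewrite mulrC.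
  over.
rewrite /= exchange_big /=; apply: eq_bigr => l _.
by rewrite sum_pick.
Qed.


Lemma is_homM U V W f g : is_hom V W f -> is_hom U V g -> is_hom U W (f *m g).
Proof. by move=> hf hg x Gx; rewrite mulmxA hf // -!mulmxA hg. Qed.

Lemma is_hom1 V : is_hom V V 1%:M.
Proof. by move=> x _; rewrite mul1mx mulmx1. Qed.

Lemma tprod_hom V W V' W' (f : 'M[F]_(rdegree V', rdegree V))
    (g : 'M[F]_(rdegree W', rdegree W)) :
  is_hom V V' f -> is_hom W W' g -> is_hom (tens V W) (tens V' W') (tprod f g).
Proof. by move=> hf hg x Gx; rewrite /= -!tprodE hf ?hg. Qed.

Lemma ev_hom V : is_hom (tens (dual V) V) (unit_obj F G) (ev V).
Proof.
move=> g Gg; rewrite [LHS]mul1mx; apply/rowP => s.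
case/mxvec_indexP: s => i j; rewrite evE [RHS]mxE sum_mxvec exchange_big /=.
under eq_bigr => b _.
  under eq_bigr => a _ do rewrite evE tprod_index mxE.
  rewrite sum_pick; over.
have := repr_mxM V (groupVr Gg) Gg; rewrite mulVg repr_mx1.
by move=> /matrixP/(_ i j); rewrite !mxE => ->.
Qed.

Lemma coev_hom V : is_hom (unit_obj F G) (tens V (dual V)) (coev V).
Proof.
move=> g Gg; rewrite [RHS]mulmx1; apply/colP => s.
case/mxvec_indexP: s => i j; rewrite coevE [LHS]mxE sum_mxvec /=.
under eq_bigr => a _.
  under eq_bigr => b _ do rewrite coevE tprod_index mxE eq_sym.
  rewrite sum_pickr; over.
have := repr_mxM V Gg (groupVr Gg); rewrite mulgV repr_mx1.
by move=> /matrixP/(_ i j); rewrite !mxE => ->.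
Qed.

Lemma braid_hom V W : is_hom (tens V W) (tens W V) (braid V W).
Proof.
move=> g Gg; apply/matrixP => s t.
case/mxvec_indexP: s => j i; case/mxvec_indexP: t => i' j'.
rewrite !mxE !sum_mxvec exchange_big /=.
transitivity (V g i i' * W g j j').
  under eq_bigr => a _.
    under eq_bigr => b _ do rewrite braidE tprod_index mulrA.
    rewrite sum_pickr; over.
  by rewrite sum_pickr mulrC.
under eq_bigr => a _.
  under eq_bigr => b _ do
    rewrite braidE tprod_index (eq_sym i) (eq_sym j) mulrC mulrA.
  rewrite sum_pickr; over.
by rewrite /= sum_pickr.
Qed.

Lemma assoc_hom V W U :
  is_hom (tens V (tens W U)) (tens (tens V W) U) (assoc V W U).
Proof.
move=> g Gg; apply/matrixP => s t.
case/mxvec_indexP: s => s l; case/mxvec_indexP: s => i j.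
case/mxvec_indexP: t => i' t; case/mxvec_indexP: t => j' l'.
rewrite mul_assoc (_ : (assoc V W U *m _) _ _ =
  ((tens V (tens W U) g)^T *m (assoc V W U)^T)
    (mxvec_index i' (mxvec_index j' l')) (mxvec_index (mxvec_index i j) l));
  last by rewrite -trmx_mul [RHS]mxE.
rewrite mul_assocT mxE /=.
by rewrite !tprod_index mulrA.
Qed.

Lemma assocK V W U : assoc V W U *m (assoc V W U)^T = 1%:M.
Proof.
apply/matrixP => s t; case/mxvec_indexP: t => t l; case/mxvec_indexP: t => i j.
case/mxvec_indexP: s => s l'; case/mxvec_indexP: s => i' j'.
by rewrite mul_assocT assocE mxE !mxvec_index_eq -andbA -!mulnb !natrM.
Qed.

Lemma assocVK V W U : (assoc V W U)^T *m assoc V W U = 1%:M.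
Proof.
apply/matrixP => s t; case/mxvec_indexP: t => i t; case/mxvec_indexP: t => j l.
case/mxvec_indexP: s => i' s; case/mxvec_indexP: s => j' l'.
rewrite mul_assoc [LHS]mxE assocE [RHS]mxE !mxvec_index_eq.
by rewrite (eq_sym i') (eq_sym j') (eq_sym l') -!mulnb !natrM.
Qed.

Lemma mul_unitl W m (M : 'M[F]_(m, rdegree W)) i j :
  (M *m unitl W) i (mxvec_index ord0 j) = M i j.
Proof.
rewrite mxE; under eq_bigr => l _ do rewrite unitlE.
by rewrite sum_pickr.
Qed.

Lemma mul_unitr V m (M : 'M[F]_(m, rdegree V)) i j :
  (M *m unitr V) i (mxvec_index j ord0) = M i j.
Proof.
rewrite mxE; under eq_bigr => l _ do rewrite unitrE.
by rewrite sum_pickr.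
Qed.

Lemma unitl_hom W : is_hom (tens (unit_obj F G) W) W (unitl W).
Proof.
move=> g Gg; apply/matrixP => i s; case/mxvec_indexP: s => o j.
rewrite (ord1 o) mul_unitl mxE sum_mxvec [RHS]big_ord1.
under eq_bigr => l _ do rewrite unitlE tprod_index [1%:M _ _]mxE mul1r eq_sym.
by rewrite sum_pick.
Qed.

Lemma unitr_hom V : is_hom (tens V (unit_obj F G)) V (unitr V).
Proof.
move=> g Gg; apply/matrixP => i s; case/mxvec_indexP: s => j o.
rewrite (ord1 o) mul_unitr mxE sum_mxvec.
under eq_bigr => l _.
  rewrite [\sum_j0 _]big_ord1 unitrE tprod_index [1%:M _ _]mxE mulr1 eq_sym.
  over.
by rewrite sum_pick.
Qed.

Lemma unitlK W : unitl W *m (unitl W)^T = 1%:M.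
Proof.
apply/matrixP => i j; rewrite mxE sum_mxvec [LHS]big_ord1.
by under eq_bigr => l _ do rewrite mxE !unitlE (eq_sym j);
  rewrite sum_pickr mxE.
Qed.

Lemma unitlVK W : (unitl W)^T *m unitl W = 1%:M.
Proof.
apply/matrixP => s t; case/mxvec_indexP: t => o t; case/mxvec_indexP: s => o' s.
rewrite (ord1 o) (ord1 o') mul_unitl !mxE.
by rewrite unitlE mxvec_index_eq eqxx eq_sym.
Qed.

Lemma unitrK V : unitr V *m (unitr V)^T = 1%:M.
Proof.
apply/matrixP => i j; rewrite mxE sum_mxvec.
under eq_bigr => l _ do
  rewrite [\sum_j0 _]big_ord1 mxE !unitrE (eq_sym j).
by rewrite sum_pickr mxE.
Qed.

Lemma unitrVK V : (unitr V)^T *m unitr V = 1%:M.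
Proof.
apply/matrixP => s t; case/mxvec_indexP: t => t o; case/mxvec_indexP: s => s o'.
rewrite (ord1 o) (ord1 o') mul_unitr !mxE.
by rewrite unitrE mxvec_index_eq eqxx andbT eq_sym.
Qed.

Lemma is_homV V W f f' :
  is_hom V W f -> f *m f' = 1%:M -> f' *m f = 1%:M -> is_hom W V f'.
Proof.
move=> hf ff' f'f g Gg.
by rewrite -[V g]mul1mx -f'f -!mulmxA [f *m _]mulmxA -hf // -mulmxA ff' mulmx1.
Qed.

Lemma coev'_hom V : is_hom (unit_obj F G) (tens (dual V) V) (coev' V).
Proof. exact: is_homM (@braid_hom _ _) (@coev_hom _). Qed.

Lemma ev'_hom V : is_hom (tens V (dual V)) (unit_obj F G) (ev' V).
Proof. exact: is_homM (@ev_hom _) (@braid_hom _ _). Qed.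

Lemma tr_L_hom V W f :
  is_hom (tens V W) (tens V W) f -> is_hom W W (tr_L V W f).
Proof.
move=> hf.
apply: (is_homM (V := tens (unit_obj F G) W)); last first.
  exact: is_homV (@unitl_hom _) (unitlK _) (unitlVK _).
apply: (is_homM (V := tens (tens (dual V) V) W)); last first.
  by apply: tprod_hom (@is_hom1 _); apply: coev'_hom.
apply: (is_homM (V := tens (dual V) (tens V W))); last first.
  exact: is_homV (@assoc_hom _ _ _) (assocK _ _ _) (assocVK _ _ _).
apply: (is_homM (V := tens (dual V) (tens V W))); last first.
  exact: tprod_hom (@is_hom1 _) hf.
apply: is_homM (@assoc_hom _ _ _).
apply: is_homM (@unitl_hom _) _.
exact: tprod_hom (@ev_hom _) (@is_hom1 _).
Qed.

Lemma tr_R_hom V W f :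
  is_hom (tens V W) (tens V W) f -> is_hom V V (tr_R V W f).
Proof.
move=> hf.
apply: (is_homM (V := tens V (unit_obj F G))); last first.
  exact: is_homV (@unitr_hom _) (unitrK _) (unitrVK _).
apply: (is_homM (V := tens V (tens W (dual W)))); last first.
  exact: tprod_hom (@is_hom1 _) (@coev_hom _).
apply: is_homM (@assoc_hom _ _ _).
apply: (is_homM (V := tens (tens V W) (dual W))); last first.
  exact: tprod_hom hf (@is_hom1 _).
apply: (is_homM (V := tens V (tens W (dual W)))); last first.
  exact: is_homV (@assoc_hom _ _ _) (assocK _ _ _) (assocVK _ _ _).
apply: is_homM (@unitr_hom _) _.
exact: tprod_hom (@is_hom1 _) (@ev'_hom _).
Qed.

Lemma End_mxP V f : reflect (is_hom V V f) (f \in End_mx V)%MS.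
Proof.
rewrite /End_mx memmx_cent_envelop; apply: (iffP centgmxP) => h x Gx;
  by rewrite h.
Qed.

End CategoryTheory.

Section CanonicalTrace.
Variables (F : closedFieldType) (gT : finGroupType) (G : {group gT}).
Variable J : representation F G.
Implicit Types f g : 'M[F]_(rdegree J).

Lemma eigenvalue_unitmx f a : eigenvalue f a = (f - a%:M \notin unitmx).
Proof. by rewrite /eigenvalue /eigenspace kermx_eq0 row_free_unit. Qed.

Lemma eigenvalue0 f : eigenvalue f 0 = (f \notin unitmx).
Proof.
rewrite eigenvalue_unitmx (_ : f - 0%:M = f) //.
by apply/matrixP => i j; rewrite !mxE mul0rn subr0.
Qed.

Lemma sub_hom_module p f : is_hom J J f -> mxmodule J (kermxpoly f p).
Proof.
move=> hf; apply/mxmoduleP => x Gx.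
by apply: comm_mx_stable_kermxpoly; rewrite /comm_mx hf.
Qed.

Lemma indecomposable_coprime p q f : indecomposable J -> is_hom J J f ->
  coprimep p q -> (kermxpoly f (p * q) :=: 1%:M)%MS ->
  kermxpoly f p = 0 \/ kermxpoly f q = 0.
Proof.
move=> [_ indJ] hf copq e1.
have mp := sub_hom_module p hf; have mq := sub_hom_module q hf.
have m1 : mxmodule J (1%:M : 'M_(rdegree J)) by apply: mxmodule1.
have e : (kermxpoly f p + kermxpoly f q :=: 1%:M)%MS.
  by apply: eqmx_trans e1; apply: eqmx_sym; apply: kermxpolyM.
have d : mxdirect (kermxpoly f p + kermxpoly f q).
  by apply/mxdirect_addsP; apply: mxdirect_kermxpoly.
have rs := @mx_rsim_dadd _ _ _ _ J _ _ _ (Representation (submod_repr mp))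
  (Representation (submod_repr mq)) mp mq m1 e d (mx_rsim_refl _) (mx_rsim_refl _).
have {}rs := mx_rsim_trans (mx_rsim_sym (rsim_submod1 m1 (@eqmx_refl _ _ _ _))) rs.
case: (indJ _ _ rs) => /= /eqP; rewrite mxrank_eq0 => /eqP ->; [by left | by right].
Qed.

Lemma indecomposable_eigen f : indecomposable J -> is_hom J J f ->
  exists2 a, eigenvalue f a & forall b, eigenvalue f b -> b = a.
Proof.
move=> indJ hf.
have n0 := indJ.1.
have [a ea] : exists a, eigenvalue f a.
  move: n0 f {hf}; case: (rdegree J) => // n _ f.
  have /closed_rootP[a ra] : size (char_poly f) != 1%N by rewrite size_char_poly.
  by exists a; rewrite eigenvalue_root_char.
exists a => // b eb; apply/eqP; apply: contraT => neq_ba.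
have char0 : char_poly f != 0 by rewrite monic_neq0 ?char_poly_monic.
have [m [q + ech]] := multiplicity_XsubC (char_poly f) a.
rewrite char0 /= => rq.
have cop : coprimep q (('X - a%:P) ^+ m).
  by rewrite coprimep_expr // coprimep_XsubC.
have e1 : (kermxpoly f (q * ('X - a%:P) ^+ m) :=: 1%:M)%MS.
  rewrite -ech; move: n0 f {hf ea eb char0 rq ech cop}; case: (rdegree J) => // n _ f.
  by apply: kermxpoly_min; rewrite mxminpoly_dvd_char.
have root_ker c p : eigenvalue f c -> root p c -> kermxpoly f p != 0.
  move=> ec /factor_theorem[r ->]; move: ec; rewrite eigenvalue_poly.
  rewrite mulrC => /eigenpolyP[v vf v0]; apply/eigenpolyP; exists v => //.
  move: v0 vf; rewrite /kermxpoly; move: f {ea hf eb char0 rq ech cop e1} v n0.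
  case: (rdegree J) => // n f v _ _ /sub_kermxP h; apply/sub_kermxP.
  by rewrite rmorphM /= -mulmxE mulmxA h mul0mx.
have rb : root (char_poly f) b by rewrite -eigenvalue_root_char.
have ra : root (char_poly f) a by rewrite -eigenvalue_root_char.
have qb : root q b.
  move: rb; rewrite ech rootM => /orP[] //.
  by rewrite /root horner_exp expf_eq0 !hornerE subr_eq0 (negPf neq_ba) andbF.
have ma : root (('X - a%:P) ^+ m) a.
  by move: ra; rewrite ech rootM (negPf rq).
have [/eqP|/eqP] := indecomposable_coprime indJ hf cop e1.
  by rewrite (negPf (root_ker _ _ eb qb)).
by rewrite (negPf (root_ker _ _ ea ma)).
Qed.

Lemma singular_radical f : indecomposable J -> is_hom J J f ->
  eigenvalue f 0 -> in_radical J f.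
Proof.
move=> indJ hf f0; split=> [|S [ltS idS maxS]]; first exact/End_mxP.
apply: contraT => fS.
have n0 := indJ.1.
have sSE : (S <= End_mx J)%MS by exact: ltmxW.
have id1 : (1%:M \in End_mx J)%MS by apply/End_mxP => x _; rewrite mul1mx mulmx1.
pose T := (S + End_mx J * mxvec f)%MS.
have fT : (f \in T)%MS.
  apply/memmx_addsP; exists (0, f); rewrite /= add0r; split=> //.
    by rewrite mem0mx.
  by rewrite -[f in (f \in _)%MS]mul1mx mem_mulsmx.
have EE : (End_mx J * End_mx J <= End_mx J)%MS by apply: cent_mx_ideal.
have idT : left_mx_ideal (End_mx J) T.
  rewrite /left_mx_ideal /T mulsmxDr addsmxS // mulsmxA; exact: mulsmxS.
have sTE : (T <= End_mx J)%MS.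
  rewrite addsmx_sub sSE (submx_trans _ EE) // mulsmxS //.
  by apply/End_mxP.
have nlt : ~~ (T < End_mx J)%MS.
  apply/negP => /maxS/(_ idT (addsmxSl _ _))/(submx_trans fT).
  exact/negP.
have : (1%:M \in T)%MS.
  by apply: submx_trans id1 _; move: nlt; rewrite ltmxE sTE /= negbK.
case/memmx_addsP => -[s t] /= [sS /mulsmxP[A1 A1E [A2 A2f]] et e1].
have [g hg eg] : exists2 g, is_hom J J g & t = g *m f.
  have h i : exists c, A2 i = c *: f.
    by have /sub_rVP[c e] := A2f i; exists c; apply: (can_inj mxvecK); rewrite linearZ.
  have [c hc] := boolp.choice h.
  exists (\sum_i c i *: A1 i).
    apply/End_mxP; rewrite linear_sum summx_sub // => i _; rewrite linearZ.
    exact/scalemx_sub/A1E.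
  by rewrite et mulmx_suml; apply: eq_bigr => i _; rewrite hc -scalemxAl -scalemxAr.
have eS : s = 1%:M - g *m f by rewrite -eg e1 addrK.
have hgf : is_hom J J (g *m f) by apply: is_homM.
have us : s \in unitmx.
  have [a _ uniq] := indecomposable_eigen indJ hgf.
  apply: contraT => nus.
  have e0 : eigenvalue (g *m f) 0.
    move: f0; rewrite !eigenvalue0 unitmx_mul negb_and => ->.
    by rewrite orbT.
  have e1' : eigenvalue (g *m f) 1.
    by rewrite eigenvalue_unitmx -opprB -scaleN1r unitmxZ ?unitrN1 // -eS.
  by have := oner_neq0 F; rewrite (uniq _ e1') -(uniq _ e0) eqxx.
have hs : is_hom J J (invmx s).
  move=> x Gx; have ex : J x *m s = s *m J x.
    by rewrite eS mulmxBl mulmxBr mul1mx mulmx1 hgf.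
  by rewrite -[LHS](mulKmx us) [s *m _]mulmxA -ex -mulmxA mulmxV // mulmx1.
have : (1%:M \in S)%MS.
  apply: submx_trans _ idS; rewrite -(mulVmx us); apply: mem_mulsmx => //.
  exact/End_mxP.
move=> S1; case/negP: (proj2 (andP ltS)); apply: submx_trans idS.
apply/memmx_subP => A EA; rewrite -[A]mulmx1; exact: mem_mulsmx.
Qed.

Lemma ex_max_left_ideal : (0 < rdegree J)%N -> exists S, max_left_ideal J S.
Proof.
move=> n0.
pose P r := boolp.asbool (exists S : 'A[F]_(rdegree J),
  [/\ (S < End_mx J)%MS, left_mx_ideal (End_mx J) S & \rank S = r]).
have exP : exists r, P r.
  exists 0%N; apply/boolp.asboolP; exists 0; split; last exact: mxrank0.
    rewrite ltmxE sub0mx; apply/negP => le0.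
    have id1 : (1%:M \in End_mx J)%MS.
      by apply/End_mxP => x _; rewrite mul1mx mulmx1.
    have := submx_trans id1 le0.
    move/memmx0; move: n0; case: (rdegree J) => // n _ /eqP.
    by rewrite (oner_eq0 'M[F]_n.+1).
  by rewrite /left_mx_ideal mulsmx0 submx_refl.
have ubP r : P r -> (r <= rdegree J ^ 2)%N.
  by move=> /boolp.asboolP[S [_ _ <-]]; apply: rank_leq_row.
case: (ex_maxnP exP ubP) => r /boolp.asboolP[S [ltS idS rS]] maxr.
exists S; split=> // T ltT idT sST.
rewrite -(geq_leqif (mxrank_leqif_sup sST)) rS maxr //.
by apply/boolp.asboolP; exists T.
Qed.

(* For J indecomposable, [ctrace J] is thus the canonical projection of       *)
(* End(J) onto End(J) / Rad(End(J)) = k.                                      *)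
Lemma ctraceP f c : indecomposable J -> is_hom J J f ->
  in_radical J (f - c%:M) <-> ctrace J f = c.
Proof.
move=> indJ hf.
have hsub a : is_hom J J (f - a%:M).
  by move=> x Gx; rewrite mulmxBl mulmxBr hf // scalar_mxC.
have [a ea _] := indecomposable_eigen indJ hf.
have ra : in_radical J (f - a%:M).
  apply: singular_radical => //; move: ea; by rewrite eigenvalue0 eigenvalue_unitmx.
have uniq b d : in_radical J (f - b%:M) -> in_radical J (f - d%:M) -> b = d.
  move=> [_ rb] [_ rd]; have [S maxS] := ex_max_left_ideal indJ.1.
  apply/eqP; rewrite -subr_eq0; apply: contraT => nz.
  have [ltS idS _] := maxS.
  have : ((b - d)^-1 *: ((f - d%:M) - (f - b%:M)) \in S)%MS.
    by rewrite linearZ scalemx_sub // linearB addmx_sub ?eqmx_opp ?rb ?rd.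
  have -> : (f - d%:M) - (f - b%:M) = (b - d)%:M.
    apply/matrixP => i j; rewrite !mxE mulrnBl.
    by rewrite opprB [LHS]addrC addrA subrK.
  rewrite scale_scalar_mx mulVf // => S1.
  case/negP: (proj2 (andP ltS)); apply: submx_trans idS.
  by apply/memmx_subP => A EA; rewrite -[A]mulmx1; apply: mem_mulsmx.
have rc : in_radical J (f - (ctrace J f)%:M).
  exact: (@classical_sets.xgetI _ 0 (fun c => in_radical J (f - c%:M)) a ra).
by split=> [r|<-] //; apply: uniq rc r.
Qed.

End CanonicalTrace.

Section KleinFour.

Variable k : fieldType.

(* The Klein four group, with g = (1, 0) and h = (0, 1). *)
Definition V4 : {group ('Z_2 * 'Z_2)%type} := [set: ('Z_2 * 'Z_2)%type]%G.

Definition jordan_block n (alpha : k) : 'M[k]_n :=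
  \matrix_(i, j) (alpha *+ (i == j) + ((i.+1 == j)%N)%:R).

Definition xmx n : 'M[k]_(n + n) := block_mx 0 1%:M 0 0.

Definition ymx n alpha : 'M[k]_(n + n) := block_mx 0 (jordan_block n alpha) 0 0.

Hypothesis char2 : 2%N \in [pchar k].

(* g^a h^b acts by (1 + x)^a (1 + y)^b = 1 + a x + b y, since x y = 0. *)
Lemma Vmod_mx_repr n alpha :
  mx_repr V4 (fun u : ('Z_2 * 'Z_2)%type =>
    1%:M + (u.1 : nat)%:R *: xmx n + (u.2 : nat)%:R *: ymx n alpha).
Proof.
have xy0 (A B : 'M[k]_n) :
    block_mx 0 A 0 0 *m block_mx 0 B 0 0 = 0 :> 'M_(n + n).
  by rewrite mulmx_block !mulmx0 !mul0mx !addr0 -block_mx0.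
split=> [|u v _ _]; first by rewrite !scale0r !addr0.
have natZ2 (a b : 'Z_2) : ((a * b)%g : nat)%:R = (a : nat)%:R + (b : nat)%:R :> k.
  by rewrite -natrD -[RHS](GRing.natr_mod_pchar char2).
rewrite !natZ2 !scalerDl !mulmxDl !mulmxDr !mulmx1 !mul1mx.
rewrite -!scalemxAl -!scalemxAr !xy0 !scaler0 !addr0.
by rewrite (AC (1*2*2) (1*3*5*2*4)).
Qed.

Definition Vmod n alpha : representation k V4 :=
  Representation (MxRepresentation (Vmod_mx_repr n alpha)).

End KleinFour.

(* Main.v *)
(* Write J = V_1(alpha) with basis e0, e1 and x e1 = e0.  An endomorphism f   *)
(* of J (x) J commutes with a X + a^2 Z for a = 1 and a = alpha, where        *)
(* X = x (x) 1 + 1 (x) x and Z = x (x) x.  As alpha <> 0, 1, it commutes with *)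
(* X and Z, which forces the diagonal entries of f at e0 (x) e1 and           *)
(* e1 (x) e0 to agree; their difference is that of the canonical traces of    *)
(* the two partial traces.                                                    *)
(* With c = alpha^2 - alpha <> 0, the vectors c e00, e00 + e01 + e10, c e01,  *)
(* e11 form a basis of J (x) J identifying it with V_2(alpha).  Ambidexterity *)
(* makes the canonical trace of the right partial trace cyclic, so that the   *)
(* modified dimension can be computed from this isomorphism: it is the        *)
(* canonical trace of dim(J) Id = 2 Id = 0.                                   *)
Require Import Defs.
From mathcomp Require Import all_boot all_order all_algebra all_fingroup.
From mathcomp Require Import all_solvable all_field all_character.
From mathcomp Require Import ring zify.

Import GRing.Theory.
Local Open Scope ring_scope.

(** Put J = V_1(alpha). Its endomorphisms are upper triangular with constant diagonal, so the
    canonical trace reads off a diagonal entry ([Vmod1_ctrace]), and ambidexterity becomes the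
    equality of two diagonal entries of f proved in [comm_shear]. For any J with ambidextrous
    canonical trace, the trace of [tr_R] satisfies <tr_R(fg)> = <tr_R(gf)> for maps between J (x) V
    and J (x) W ([ctrace_tr_RC]). Since V_2(alpha) is isomorphic to J (x) J ([Vmod2_emb_hom],
    [Vmod2_projK]), the idempotent defining the modified dimension can be rotated into the identity
    of J (x) J, whose partial trace is 2 = 0. *)

Section Kronecker.

Context {F : fieldType} {m1 n1 m2 n2 : nat}.
Variables (A : 'M[F]_(m1, n1)) (B : 'M[F]_(m2, n2)).

Lemma mul_tprodE p (f : 'M_(n1 * n2, p)) i j t :
  (tprod A B *m f) (mxvec_index i j) t =
    \sum_a \sum_b A i a * B j b * f (mxvec_index a b) t.
Proof.
rewrite mxE sum_mxvec; apply: eq_bigr => a _; apply: eq_bigr => b _.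
by rewrite tprod_index.
Qed.

Lemma mul_mx_tprodE p (f : 'M_(p, m1 * m2)) i j t :
  (f *m tprod A B) t (mxvec_index i j) =
    \sum_a \sum_b f t (mxvec_index a b) * (A a i * B b j).
Proof.
rewrite mxE sum_mxvec; apply: eq_bigr => a _; apply: eq_bigr => b _.
by rewrite tprod_index.
Qed.

End Kronecker.

(** * Partial traces and their cyclicity *)

Section PartialTrace.

Context {F : fieldType} {gT : finGroupType} {G : {group gT}}.
Implicit Types U V W J : representation F G.

Lemma mul_braid_tprod1 U V W m (M : 'M[F]_(m, rdegree (tens (tens V U) W))) r i j l :
  (M *m tprod (braid U V) (1%:M : 'M_(rdegree W)))
    r (mxvec_index (mxvec_index i j) l) = M r (mxvec_index (mxvec_index j i) l).
Proof.
rewrite mxE sum_mxvec.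
under eq_bigr => a _.
  under eq_bigr => b _ do rewrite tprod_index [1%:M _ _]mxE mulrA.
  rewrite sum_pickr; over.
rewrite sum_mxvec; under eq_bigr => a _.
  under eq_bigr => b _ do rewrite braidE mulrA.
  rewrite -mulr_suml sum_pickr; over.
exact: sum_pickr.
Qed.

(** This is Id_J (x) f, conjugated by associators. *)
Definition tens_assoc_map J V W (f : 'M[F]_(rdegree (tens J W), rdegree (tens J V))) :
    'M_(rdegree (tens (tens J J) W), rdegree (tens (tens J J) V)) :=
  assoc J J W *m tprod (1%:M : 'M_(rdegree J)) f *m (assoc J J V)^T.

Lemma tens_assoc_map_hom J V W f : is_hom (tens J V) (tens J W) f ->
  is_hom (tens (tens J J) V) (tens (tens J J) W) (tens_assoc_map J V W f).
Proof.
move=> hf; apply: is_homM (is_homV (@assoc_hom _ _ _ _ _ _) (assocK _ _ _) (assocVK _ _ _)).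
apply: is_homM (@assoc_hom _ _ _ _ _ _) _.
exact: tprod_hom (@is_hom1 _ _ _ _) hf.
Qed.

Lemma tens_assoc_mapE J V W f i1 i2 w j1 j2 v :
  tens_assoc_map J V W f (mxvec_index (mxvec_index i1 i2) w)
    (mxvec_index (mxvec_index j1 j2) v)
  = (i1 == j1)%:R * f (mxvec_index i2 w) (mxvec_index j2 v).
Proof.
rewrite mul_assocT -[assoc _ _ _]trmxK -[tprod _ _]trmxK -trmx_mul mxE.
by rewrite mul_assocT mxE tprod_index mxE.
Qed.

(* The partial trace over W of K is an endomorphism of J (x) J in which f and *)
(* g are composed crosswise, so that its left and right partial traces are    *)
(* those of fg and gf.                                                        *)
Lemma ctrace_tr_RC J V W (f : 'M[F]_(rdegree (tens J W), rdegree (tens J V)))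
    (g : 'M[F]_(rdegree (tens J V), rdegree (tens J W))) :
  ctrace_ambidextrous J -> is_hom (tens J V) (tens J W) f ->
  is_hom (tens J W) (tens J V) g ->
  ctrace J (tr_R J W (f *m g)) = ctrace J (tr_R J V (g *m f)).
Proof.
move=> ambJ hf hg.
pose K := tens_assoc_map _ _ _ f *m tprod (braid J J) (1%:M : 'M_(rdegree V))
  *m tens_assoc_map _ _ _ g.
have hK : is_hom (tens (tens J J) W) (tens (tens J J) W) K.
  apply: is_homM (tens_assoc_map_hom _ _ _ _ hg).
  apply: is_homM (tens_assoc_map_hom _ _ _ _ hf) _.
  exact: tprod_hom (@braid_hom _ _ _ _ _) (@is_hom1 _ _ _ _).
have KE i1 i2 w j1 j2 w0 :
    K (mxvec_index (mxvec_index i1 i2) w) (mxvec_index (mxvec_index j1 j2) w0) =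
    \sum_v f (mxvec_index i2 w) (mxvec_index j1 v)
         * g (mxvec_index i1 v) (mxvec_index j2 w0).
  rewrite mxE !sum_mxvec.
  under eq_bigr => b _.
    under eq_bigr => a _.
      under eq_bigr => v _.
        rewrite mul_braid_tprod1 !tens_assoc_mapE (eq_sym i1) -mulrA.
        over.
      rewrite -mulr_sumr; over.
    rewrite sum_pick; over.
  under eq_bigr => a _.
    under eq_bigr => v _ do rewrite mulrCA.
    rewrite -mulr_sumr; over.
  exact: sum_pick.
have := ambJ _ (tr_R_hom hK); congr (ctrace J _ = ctrace J _); apply/matrixP => i j.
  rewrite tr_LE tr_RE; under eq_bigr => l _ do rewrite tr_RE.
  rewrite exchange_big; apply: eq_bigr => w _ /=.
  by rewrite mxE sum_mxvec; apply: eq_bigr => l _; rewrite KE.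
rewrite !tr_RE; under [RHS]eq_bigr => v _ do rewrite mxE sum_mxvec.
rewrite [RHS]exchange_big; apply: eq_bigr => l _; rewrite tr_RE [RHS]exchange_big.
apply: eq_bigr => w _; rewrite KE; apply: eq_bigr => v _; exact: mulrC.
Qed.

Lemma tr_R_id V W : tr_R V W 1%:M = (rdegree W)%:R%:M.
Proof.
apply/matrixP => i j; rewrite (tr_RE _ i j) mxE.
under eq_bigr => l _ do rewrite mxE mxvec_index_eq eqxx andbT.
by rewrite sumr_const card_ord -mulrnA mulnC mulrnA.
Qed.

End PartialTrace.

(** * V_1(alpha): indecomposability and canonical trace *)

Section KleinFour.

Context {k : closedFieldType} (char2 : 2%N \in [pchar k]).
Variable alpha : k.

Local Notation J := (Vmod char2 1%N alpha).
Local Notation i0 := (@ord0 1).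
Local Notation i1 := (lift (@ord0 1) (@ord0 0)).

Lemma ord2P (i : 'I_2) : i = i0 \/ i = i1.
Proof. by case: (unliftP ord0 i) => [j|] ->; [rewrite (ord1 j); right | left]. Qed.

Definition shear (s : k) : 'M[k]_2 := 1%:M + s *: delta_mx i0 i1.

Lemma shearE s : (shear s i0 i0 = 1) * (shear s i0 i1 = s)
  * (shear s i1 i0 = 0) * (shear s i1 i1 = 1).
Proof. by rewrite /shear !mxE /= !mulr1 !mulr0 !addr0 !add0r. Qed.

Lemma Vmod1E (u : 'Z_2 * 'Z_2) : J u = shear (u.1%:R + u.2%:R * alpha).
Proof.
apply/matrixP => i j; rewrite /= scalar_mx_block !scale_block_mx !add_block_mx.
case: (split_ordP (i : 'I_(1 + 1))) => a ->; case: (split_ordP (j : 'I_(1 + 1))) => b ->.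
all: rewrite (ord1 a) (ord1 b) ?block_mxEul ?block_mxEur ?block_mxEdl ?block_mxEdr.
all: rewrite !mxE -!val_eqE /=; ring.
Qed.

Lemma Vmod1_g : J (1, 0) = shear 1.
Proof. by rewrite Vmod1E /= mul0r addr0. Qed.

Lemma Vmod1_h : J (0, 1) = shear alpha.
Proof. by rewrite Vmod1E /= mul1r add0r. Qed.

Lemma Vmod1_endE (f : 'M_2) : is_hom J J f -> f = (f i0 i0)%:M + f i0 i1 *: delta_mx i0 i1.
Proof.
move=> hf; have /matrixP hfE := hf (1, 0) (in_setT _); rewrite Vmod1_g in hfE.
have := hfE i0 i0; have := hfE i0 i1.
rewrite !mxE !big_ord_recl !big_ord0 !shearE.
rewrite !mul1r !mulr1 !mulr0 !addr0 addrC => /addIr e11.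
rewrite -[RHS]addr0 => /addrI e10.
apply/matrixP => i j; case: (ord2P i) => ->; case: (ord2P j) => ->.
all: by rewrite !mxE /= ?mulr0n ?mulr1n ?mulr0 ?mulr1 ?addr0 ?add0r.
Qed.

(** Each u squares to 1, and 1 is the only square root of 1 in characteristic 2. *)
Lemma V4_repr1 (U : representation k V4) u : rdegree U = 1%N -> U u = 1%:M.
Proof.
case: U => n U /= n1; subst n.
have uu : (u * u)%g = 1%g.
  by case: u => -[[|[|//]] ?] [[|[|//]] ?]; apply/eqP.
have := repr_mxM U (in_setT u) (in_setT u).
rewrite uu repr_mx1 => /matrixP/(_ 0 0); rewrite !mxE big_ord1 => /esym/eqP.
rewrite -expr2 sqrf_eq1 (oppr_pchar2 char2) orbb => /eqP e.
by apply/matrixP => i j; rewrite (ord1 i) (ord1 j) e !mxE.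
Qed.

(** A proper splitting would have two one-dimensional, hence trivial, summands, but g acts
    nontrivially. *)
Lemma Vmod1_indecomposable : indecomposable J.
Proof.
split=> // U W [B e Bfree hB].
have [->|U0] := posnP (rdegree U); [by left | right].
have [//|W0] := posnP (rdegree W).
have [U1 W1] : rdegree U = 1%N /\ rdegree W = 1%N.
  by move: e U0 W0 => /=; lia.
have := hB (1, 0) (in_setT _) => /=.
rewrite !V4_repr1 // -scalar_mx_block mulmx1 -[RHS]mul1mx => /(row_free_inj Bfree).
move/matrixP/(_ i0 i1); rewrite -[LHS]/(J (1, 0) i0 i1) Vmod1_g shearE mxE /= => /eqP.
by rewrite oner_eq0.
Qed.

Lemma Vmod1_ctrace (f : 'M_2) : is_hom J J f -> ctrace J f = f i0 i0.
Proof.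
move=> hf; apply/(ctraceP _ Vmod1_indecomposable hf).
apply: singular_radical Vmod1_indecomposable _ _.
  by move=> u Vu; rewrite mulmxBl mulmxBr hf // scalar_mxC.
apply/eigenvalueP; exists (delta_mx 0 i1).
  rewrite {1}(Vmod1_endE _ hf) addrAC subrr add0r -scalemxAr mul_delta_mx_0 //.
  by rewrite scaler0 scale0r.
by apply/eqP => /matrixP/(_ 0 i1)/eqP; rewrite !mxE !eqxx oner_eq0.
Qed.

(** * Ambidexterity of V_1(alpha) *)

(* The unsimplified coefficients 1 are those of [comm_shear_entries] at s = 1. *)
Lemma linear_quadratic_eq0 (a p q : k) : a != 0 -> a != 1 ->
  1 * p + 1 ^+ 2 * q = 0 -> a * p + a ^+ 2 * q = 0 -> p = 0 /\ q = 0.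
Proof.
move=> a0 a1 e1 ea.
have q0 : q = 0.
  apply/eqP; have : a * (a - 1) * q == 0.
    apply/eqP; transitivity (a * p + a ^+ 2 * q - a * (1 * p + 1 ^+ 2 * q)); first by ring.
    by rewrite e1 ea mulr0 subrr.
  by rewrite !mulf_eq0 subr_eq0 (negPf a0) (negPf a1).
by split=> //; move: e1; rewrite q0 mulr0 addr0 mul1r.
Qed.

(** Here [tprod (shear s) (shear s)] is 1 + sX + s^2 Z; these are the entries of s[X,f] + s^2 [Z,f]
    at (00,10), (01,11) and (00,11). *)
Lemma comm_shear_entries s (f : 'M[k]_(2 * 2)) :
  let c i j i' j' := f (mxvec_index i j) (mxvec_index i' j') in
  tprod (shear s) (shear s) *m f = f *m tprod (shear s) (shear s) ->
  [/\ s * (c i0 i1 i1 i0 + c i1 i0 i1 i0 - c i0 i0 i0 i0)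
        + s ^+ 2 * c i1 i1 i1 i0 = 0,
      s * (c i1 i1 i1 i1 - c i0 i1 i0 i1 - c i0 i1 i1 i0)
        + s ^+ 2 * - c i0 i1 i0 i0 = 0
    & s * (c i0 i1 i1 i1 + c i1 i0 i1 i1 - c i0 i0 i0 i1 - c i0 i0 i1 i0)
        + s ^+ 2 * (c i1 i1 i1 i1 - c i0 i0 i0 i0) = 0].
Proof.
move=> c hf.
have hc i j i' j' : \sum_a \sum_b shear s i a * shear s j b * c a b i' j' =
    \sum_a \sum_b c i j a b * (shear s a i' * shear s b j').
  by rewrite -mul_tprodE hf mul_mx_tprodE.
move: c hc => c hc {f hf}.
split; [have := hc i0 i0 i1 i0 | have := hc i0 i1 i1 i1 | have := hc i0 i0 i1 i1].
all: rewrite !big_ord_recl !big_ord0 !shearE => /eqP; rewrite -subr_eq0 => /eqP <-; ring.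
Qed.

Lemma comm_shear (f : 'M[k]_(2 * 2)) : alpha != 0 -> alpha != 1 ->
  (forall s, s = 1 \/ s = alpha ->
     tprod (shear s) (shear s) *m f = f *m tprod (shear s) (shear s)) ->
  f (mxvec_index i1 i0) (mxvec_index i1 i0) = f (mxvec_index i0 i1) (mxvec_index i0 i1).
Proof.
move=> a0 a1 hf.
have [A1 B1 C1] := comm_shear_entries _ _ (hf 1 (or_introl erefl)).
have [Aa Ba Ca] := comm_shear_entries _ _ (hf alpha (or_intror erefl)).
have [{A1 Aa} A _] := linear_quadratic_eq0 _ _ _ a0 a1 A1 Aa.
have [{B1 Ba} B _] := linear_quadratic_eq0 _ _ _ a0 a1 B1 Ba.
have [_ {C1 Ca} C] := linear_quadratic_eq0 _ _ _ a0 a1 C1 Ca.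
apply/eqP; rewrite -subr_eq0; apply/eqP.
move: A B C; set x := f _ _; set y := f _ _; set z := f _ _; set t := f _ _.
set w := f _ _ => A B C.
(* The off-diagonal entry at (01,10) and the two corner diagonal entries cancel. *)
by transitivity ((x + y - z) + (t - w - x) - (t - z)); [ring | rewrite A B C !addr0 subrr].
Qed.

Lemma Vmod1_ambidextrous : alpha != 0 -> alpha != 1 -> ctrace_ambidextrous J.
Proof.
move=> a0 a1 f hf.
rewrite !Vmod1_ctrace; [|exact: tr_R_hom|exact: tr_L_hom].
rewrite (tr_LE f i0 i0) (tr_RE f i0 i0) [LHS]big_ord_recl [RHS]big_ord_recl.
congr (_ + _); rewrite [LHS]big_ord1 [RHS]big_ord1.
apply: (comm_shear f a0 a1) => s [] ->.
  by rewrite -Vmod1_g; apply: hf; rewrite in_setT.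
by rewrite -Vmod1_h; apply: hf; rewrite in_setT.
Qed.

(** * V_2(alpha) as J (x) J, and its modified dimension *)

Let c := alpha ^+ 2 - alpha.

Definition Vmod2_embl : 'M[k]_(2 * 2, 2) := \matrix_(s, m)
  mxvec (if m == i0 then c *: delta_mx i0 i0
         else delta_mx i0 i0 + delta_mx i0 i1 + delta_mx i1 i0) 0 s.

Definition Vmod2_embr : 'M[k]_(2 * 2, 2) := \matrix_(s, m)
  mxvec (if m == i0 then c *: delta_mx i0 i1 else delta_mx i1 i1) 0 s.

Definition Vmod2_projl : 'M[k]_(2, 2 * 2) := \matrix_(m, s)
  mxvec (if m == i0 then c^-1 *: (delta_mx i0 i0 - delta_mx i1 i0)
         else delta_mx i1 i0) 0 s.

Definition Vmod2_projr : 'M[k]_(2, 2 * 2) := \matrix_(m, s)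
  mxvec (if m == i0 then c^-1 *: (delta_mx i0 i1 - delta_mx i1 i0)
         else delta_mx i1 i1) 0 s.

Definition Vmod2_emb := row_mx Vmod2_embl Vmod2_embr.
Definition Vmod2_proj := col_mx Vmod2_projl Vmod2_projr.

Lemma Vmod2_projK : c != 0 -> Vmod2_proj *m Vmod2_emb = 1%:M.
Proof.
move=> c0; rewrite mul_col_row [RHS]scalar_mx_block.
congr block_mx; apply/matrixP => i j; rewrite mxE sum_mxvec.
all: under eq_bigr => a _ do under eq_bigr => b _ do rewrite 2!mxE 2!mxvecE.
all: case: (ord2P i) => ->; case: (ord2P j) => ->; rewrite /= !big_ord_recl !big_ord0.
all: rewrite !mxE /=.
all: by field.
Qed.

Lemma Vmod2E (u : 'Z_2 * 'Z_2) : Vmod char2 2%N alpha u =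
  block_mx 1%:M (u.1%:R%:M + u.2%:R *: jordan_block 2 alpha) 0 1%:M.
Proof.
rewrite /= [1%:M]scalar_mx_block !scale_block_mx !add_block_mx.
by rewrite !scaler0 !addr0 !add0r scale_scalar_mx mulr1.
Qed.

Lemma Vmod2_emblE i j m : Vmod2_embl (mxvec_index i j) m =
  (if m == i0 then c *: delta_mx i0 i0
   else delta_mx i0 i0 + delta_mx i0 i1 + delta_mx i1 i0) i j.
Proof. by rewrite mxE mxvecE. Qed.

Lemma Vmod2_embrE i j m : Vmod2_embr (mxvec_index i j) m =
  (if m == i0 then c *: delta_mx i0 i1 else delta_mx i1 i1) i j.
Proof. by rewrite mxE mxvecE. Qed.

Lemma shear_embl s : tprod (shear s) (shear s) *m Vmod2_embl = Vmod2_embl.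
Proof.
have ss : s + s = 0 by exact: addrr_pchar2.
apply/matrixP => t m; case/mxvec_indexP: t => i j.
rewrite mul_tprodE Vmod2_emblE.
under eq_bigr => a _ do under eq_bigr => b _ do rewrite Vmod2_emblE.
case: (ord2P i) => ->; case: (ord2P j) => ->; case: (ord2P m) => -> /=.
all: rewrite !big_ord_recl !big_ord0 !shearE !mxE /=; try ring.
by transitivity (1 + (s + s)); [ring | rewrite ss !addr0].
Qed.

Lemma shear_embr a b s : s = a + b * alpha -> s ^+ 2 = a + b * alpha ^+ 2 ->
  tprod (shear s) (shear s) *m Vmod2_embr
    = Vmod2_embl *m (a%:M + b *: jordan_block 2 alpha) + Vmod2_embr.
Proof.
move=> es es2; apply/matrixP => t m; case/mxvec_indexP: t => i j.
rewrite mul_tprodE [RHS]mxE [X in _ = X + _]mxE Vmod2_embrE.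
under eq_bigr => u _ do under eq_bigr => v _ do rewrite Vmod2_embrE.
under [X in _ = X + _]eq_bigr => u _ do rewrite Vmod2_emblE.
case: (ord2P i) => ->; case: (ord2P j) => ->; case: (ord2P m) => -> /=.
all: rewrite !big_ord_recl !big_ord0 !shearE !mxE /= ?mulr1n ?mulr0n; try (rewrite ?es; ring).
all: transitivity (s ^+ 2); [ring | rewrite es2 /c; ring].
Qed.

Lemma Vmod2_emb_hom : is_hom (Vmod char2 2%N alpha) (tens J J) Vmod2_emb.
Proof.
move=> u _; have -> : tens J J u = tprod (J u) (J u) by [].
rewrite Vmod2E Vmod1E [LHS]mul_mx_row [RHS]mul_row_block !mulmx1 !mulmx0 addr0.
rewrite shear_embl -(shear_embr _ _ _ erefl) //.
(* The coefficients are 0 or 1, so squaring, additive in characteristic 2, only changes alpha to its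
   square. *)
have natX2 (z : 'Z_2) : (z%:R : k) ^+ 2 = z%:R.
  by case: z => [[|[|//]] ?]; rewrite /= ?expr0n ?expr1n.
by rewrite sqrrD exprMn !natX2 mulr2n (addrr_pchar2 char2) addr0.
Qed.

Lemma Vmod2_in_ideal : c != 0 -> in_ideal J (Vmod char2 2%N alpha).
Proof.
move=> c0; have KP := mulmx1C (Vmod2_projK c0).
(* V_2(alpha) fills all of J (x) J, so the complement is zero. *)
exists J, grepr0.
apply: (@MxReprSim _ _ _ _ _ _ _ (row_mx Vmod2_emb 0)); first by rewrite /= addn0.
  by apply/row_freeP; exists (col_mx Vmod2_proj 0); rewrite mul_row_col KP mulmx0 addr0.
move=> u Vu; rewrite [LHS]mul_mx_row [RHS]mul_row_block mulmx0 !mul0mx !mulmx0 !addr0.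
congr row_mx; exact: Vmod2_emb_hom.
Qed.

Lemma Vmod2_mod_dim : alpha != 0 -> alpha != 1 -> is_mod_dim J (Vmod char2 2%N alpha) 0.
Proof.
move=> a0 a1; have c0 : c != 0.
  by rewrite /c expr2 -{3}[alpha]mulr1 -mulrBr mulf_neq0 // subr_eq0.
have PK := Vmod2_projK c0; have KP := mulmx1C PK.
have projh := is_homV Vmod2_emb_hom KP PK.
split; first exact: Vmod2_in_ideal.
move=> W a b ha hb ba.
(* Factoring through J (x) J makes both factors maps between modules J (x) -, as cyclicity
   requires. *)
have -> : a *m b = (a *m Vmod2_proj) *m (Vmod2_emb *m b).
  by rewrite -mulmxA (mulmxA Vmod2_proj) PK mul1mx.
have hf := is_homM ha projh; have hg := is_homM Vmod2_emb_hom hb.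
rewrite (ctrace_tr_RC J J W _ _ (Vmod1_ambidextrous a0 a1) hf hg).
have -> : (Vmod2_emb *m b) *m (a *m Vmod2_proj) = 1%:M.
  by rewrite -mulmxA (mulmxA b) ba mul1mx KP.
rewrite Vmod1_ctrace; last exact/tr_R_hom/is_hom1.
by rewrite tr_R_id mxE mulr1n (pcharf0 char2).
Qed.

End KleinFour.

Theorem proposition7p2p2 (k : closedFieldType) (char2 : 2%N \in [pchar k])
    (alpha : k) (alpha_neq0 : alpha != 0) (alpha_neq1 : alpha != 1) :
  [/\ ctrace_ambidextrous (Vmod char2 1%N alpha),
      ambidextrous (Vmod char2 1%N alpha),
      in_ideal (Vmod char2 1%N alpha) (Vmod char2 2%N alpha)
    & is_mod_dim (Vmod char2 1%N alpha) (Vmod char2 2%N alpha) 0].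
Proof.
have amb := @Vmod1_ambidextrous _ char2 _ alpha_neq0 alpha_neq1.
have dim := @Vmod2_mod_dim _ char2 _ alpha_neq0 alpha_neq1.
by split=> //; [split=> //; exact: Vmod1_indecomposable | case: dim].
Qed.
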